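(* Let a finite group $G$ act by symmetries on a generalized probabilistic theory $T$ with state sets $\Omega$. Then $\mathcal E_{\max}=\{E:\alpha_{\vec g}(E)\in\Omega^\vee\ \text{for all tuples }\vec g\}$ is the largest sectorially closed subset of $\Omega^\vee$: it is a sectorially closed subset of $\Omega^\vee$, and every sectorially closed subset of $\Omega^\vee$ is contained in it.
   Context: Each wire of $T$ has a finite-dimensional real vector space on which $G$ acts by reversible linear maps $\alpha_g^w$ (a group action); a system is a finite list of wires with the tensor product space, and has a convex set $\Omega$ of states. For a tuple $\vec g$ of elements of $G$ indexed by the wires of a system, $\alpha_{\vec g}=\bigotimes_w\alpha_{g_w}^w$, acting on linear functionals by duality so that $\langle\alpha_{\vec g}(E),\alpha_{\vec g}(\omega)\rangle=\langle E,\omega\rangle$. For each system, $\Omega^\vee=\{E:0\le\langle E,\omega\rangle\le1\ \forall\omega\in\Omega\}$. A set (one subset for each system) of functionals is sectorially closed if it is invariant under $\alpha_{\vec g}$ for every tuple $\vec g$ and every number of wires. *)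

(* Defs.v *)
From HB Require Import structures.
From mathcomp Require Import all_boot all_order all_algebra fingroup.
From mathcomp Require Import boolp classical_sets reals convex.

Set Implicit Arguments.
Unset Strict Implicit.
Unset Printing Implicit Defensive.

Import GRing.Theory Num.Theory.

Local Open Scope classical_set_scope.
Local Open Scope ring_scope.

Section Tensor.
Variable K : fieldType.

Definition functional (V : vectType K) : vectType K := 'Hom(V, K^o).

(* In finite dimension U ⊗ V is canonically Hom(U^*, V), where u ⊗ v is the
   map phi |-> phi u *: v. This gives a basis-free tensor product of vectTypes;
   tensor_span and dim_tensor below, together with bilinearity, characterize
   it. *)
Definition tensor (U V : vectType K) : vectType K := 'Hom(functional U, V).

Definition tens (U V : vectType K) (u : U) (v : V) : tensor U V :=
  linfun (fun phi : functional U => phi u *: v).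

(* The map f ⊗ g; under the identification above it is x |-> g \o x \o f^*. *)
Definition tensor_map (U V U' V' : vectType K)
    (f : 'Hom(U, U')) (g : 'Hom(V, V')) : 'Hom(tensor U V, tensor U' V') :=
  linfun (fun x : tensor U V =>
    (g \o (x \o linfun (fun phi : functional U' => (phi \o f)%VF)))%VF).

Lemma tensE (U V : vectType K) (u : U) (v : V) (phi : functional U) :
  tens u v phi = phi u *: v.
Proof.
have lin : linear (fun phi : functional U => phi u *: v).
  by move=> a x y; rewrite lfunE /= lfunE /= scalerDl scalerA.
pose F := GRing.isLinear.Build _ _ _ _ _ lin.
pose f : {linear functional U -> V} := HB.pack (fun phi : functional U => phi u *: v) F.
exact: (lfunE f).
Qed.

Lemma tens_linearl (U V : vectType K) (a : K) (u u' : U) (v : V) :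
  tens (a *: u + u') v = a *: tens u v + tens u' v.
Proof.
apply/lfunP => phi; rewrite add_lfunE scale_lfunE !tensE.
by rewrite linearP scalerDl -scalerA.
Qed.

Lemma tens_linearr (U V : vectType K) (a : K) (u : U) (v v' : V) :
  tens u (a *: v + v') = a *: tens u v + tens u v'.
Proof.
apply/lfunP => phi; rewrite add_lfunE scale_lfunE !tensE.
by rewrite scalerDr !scalerA mulrC.
Qed.

Lemma transposeE (U U' : vectType K) (f : 'Hom(U, U')) (phi : functional U') :
  linfun (fun phi : functional U' => (phi \o f)%VF) phi = (phi \o f)%VF.
Proof.
have lin : linear (fun phi : functional U' => (phi \o f)%VF : functional U).
  by move=> a x y; apply/lfunP => z; rewrite comp_lfunE !add_lfunE !scale_lfunE !comp_lfunE.
pose F := GRing.isLinear.Build _ _ _ _ _ lin.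
pose h : {linear functional U' -> functional U} :=
  HB.pack (fun phi : functional U' => (phi \o f)%VF : functional U) F.
exact: (lfunE h).
Qed.

Lemma tensor_mapE (U V U' V' : vectType K)
    (f : 'Hom(U, U')) (g : 'Hom(V, V')) (x : tensor U V)
    (phi : functional U') :
  tensor_map f g x phi = g (x (phi \o f)%VF).
Proof.
pose H (x : tensor U V) : tensor U' V' :=
    (g \o (x \o linfun (fun phi : functional U' => (phi \o f)%VF)))%VF.
have lin : linear H.
  by move=> a y z; rewrite /H comp_lfunDl comp_lfunDr -comp_lfunZl -comp_lfunZr.
pose F := GRing.isLinear.Build _ _ _ _ _ lin.
pose h : {linear tensor U V -> tensor U' V'} := HB.pack H F.
have -> : tensor_map f g x = H x by exact: (lfunE h).
by rewrite /H !comp_lfunE transposeE.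
Qed.

Lemma tensor_map_tens (U V U' V' : vectType K)
    (f : 'Hom(U, U')) (g : 'Hom(V, V')) (u : U) (v : V) :
  tensor_map f g (tens u v) = tens (f u) (g v).
Proof.
by apply/lfunP => phi; rewrite tensor_mapE !tensE comp_lfunE linearZ.
Qed.

Lemma tensor_map_id (U V : vectType K) :
  tensor_map (\1%VF : 'End(U)) (\1%VF : 'End(V)) = \1%VF.
Proof.
apply/lfunP => x; apply/lfunP => phi.
by rewrite tensor_mapE !lfunE /= comp_lfun1r.
Qed.

Lemma tensor_map_comp (U V U1 V1 U2 V2 : vectType K)
    (f : 'Hom(U, U1)) (g : 'Hom(V, V1)) (f' : 'Hom(U1, U2)) (g' : 'Hom(V1, V2)) :
  tensor_map (f' \o f)%VF (g' \o g)%VF =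
  (tensor_map f' g' \o tensor_map f g)%VF.
Proof.
apply/lfunP => x; apply/lfunP => phi.
by rewrite comp_lfunE !tensor_mapE comp_lfunE comp_lfunA.
Qed.

Lemma dim_tensor (U V : vectType K) :
  dim (tensor U V) = (dim U * dim V)%N.
Proof. by congr (_ * _)%N; exact: muln1. Qed.

Lemma tensor_span (U V : vectType K) (x : tensor U V) :
  x = \sum_(i < \dim (@fullv K U)) tens (vbasis fullv)`_i
        (x (linfun (coord (vbasis (@fullv K U)) i : U -> K^o))).
Proof.
apply/lfunP => phi; rewrite sum_lfunE.
under eq_bigr => i _ do rewrite tensE -linearZ /=.
rewrite -linear_sum /=; congr (x _); apply/lfunP => u.
rewrite sum_lfunE {1}(coord_vbasis (memvf u)) linear_sum /=.
by apply: eq_bigr => i _; rewrite scale_lfunE lfunE linearZ; exact: mulrC.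
Qed.

End Tensor.

Section Theory.
Variable R : realType.

(* V w1 ⊗ (V w2 ⊗ ... ⊗ (V wn ⊗ R)), i.e. V w1 ⊗ ... ⊗ V wn up to the unitor. *)
Fixpoint tensor_seq (W : Type) (V : W -> vectType R) (s : seq W) : vectType R :=
  if s is w :: s' then tensor (V w) (tensor_seq V s') else R^o.

(* One set of states for each finite list of wires. *)
Record gpt := GPT {
  wire : Type;
  wire_space : wire -> vectType R;
  states : forall s : seq wire, set (tensor_seq wire_space s);
  states_convex : forall s : seq wire,
    @convex_set R (tensor_seq wire_space s) (@states s) }.

Arguments wire_space {T} w : rename.
Arguments states {T} s : rename.

Definition system (T : gpt) : Type := seq (wire T).

Definition system_space (T : gpt) (s : system T) : vectType R :=
  tensor_seq (wire_space (T := T)) s.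

Definition states_dual (T : gpt) (s : system T) :
    set (functional (system_space s)) :=
  [set E | forall x, states s x -> 0 <= E x <= 1].

Arguments states_dual {T} s.

(* Reversibility of the maps follows from the two action laws, see
   wire_act_bij. *)
Record symmetry_action (gT : finGroupType) (T : gpt) := SymmetryAction {
  wire_act : forall w : wire T, gT -> 'End(wire_space w);
  wire_act1 : forall w, wire_act w 1%g = \1%VF;
  wire_actM : forall w g h,
    wire_act w (g * h)%g = (wire_act w g \o wire_act w h)%VF }.

Section Action.
Variables (gT : finGroupType) (T : gpt) (alpha : symmetry_action gT T).

Lemma wire_act_bij (w : wire T) (g : gT) : bijective (wire_act alpha w g).
Proof.
exists (wire_act alpha w g^-1%g) => v;
  by rewrite -comp_lfunE -wire_actM ?mulVg ?mulgV wire_act1 lfunE.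
Qed.

Fixpoint system_act (s : system T) :
    (size s).-tuple gT -> 'End(system_space s) :=
  match s return (size s).-tuple gT -> 'End(system_space s) with
  | [::] => fun _ => \1%VF
  | w :: s' => fun g =>
      tensor_map (wire_act alpha w (thead g)) (system_act (behead_tuple g))
  end.

(* The dual action, characterized by functional_act_pairing. *)
Definition functional_act (s : system T) (g : (size s).-tuple gT)
    (E : functional (system_space s)) : functional (system_space s) :=
  (E \o (system_act g)^-1)%VF.

Lemma system_actV (s : system T) (g : (size s).-tuple gT) :
  (system_act g \o system_act (map_tuple (fun x => x^-1%g) g))%VF = \1%VF /\
  (system_act (map_tuple (fun x => x^-1%g) g) \o system_act g)%VF = \1%VF.
Proof.
elim: s g => [|w s IH] g /=; first by rewrite comp_lfun1l.
have -> : thead (map_tuple (fun x => x^-1%g) g) = (thead g)^-1%g.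
  by rewrite /thead tnth_map.
have -> : behead_tuple (map_tuple (fun x => x^-1%g) g) =
          map_tuple (fun x => x^-1%g) (behead_tuple g).
  by apply: val_inj; rewrite /= behead_map.
have [H1 H2] := IH (behead_tuple g).
by rewrite -!tensor_map_comp H1 H2 -!wire_actM mulgV mulVg wire_act1 tensor_map_id.
Qed.

Lemma functional_act_pairing (s : system T) (g : (size s).-tuple gT)
    (E : functional (system_space s)) (x : system_space s) :
  functional_act g E (system_act g x) = E x.
Proof.
rewrite /functional_act comp_lfunE lker0_lfunK //.
have [_ H] := system_actV g.
apply/lker0P => y z /(congr1 (system_act (map_tuple (fun x => x^-1%g) g))).
by rewrite -!comp_lfunE H !lfunE.
Qed.

Definition sectorially_closed
    (S : forall s : system T, set (functional (system_space s))) : Prop :=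
  forall (s : system T) (g : (size s).-tuple gT),
    functional_act g @` S s `<=` S s.

Definition E_max (s : system T) : set (functional (system_space s)) :=
  [set E | forall g : (size s).-tuple gT,
     states_dual s (functional_act g E)].

End Action.
End Theory.

Arguments wire_space {R T} w : rename.
Arguments states {R T} s : rename.
Arguments states_dual {R T} s.
Arguments E_max {R gT T} alpha s.

(* Main.v *)
(* The tuples of group elements indexed by the wires of a system form a group
   under pointwise multiplication, and it acts on the functionals of that
   system.  E_max is the set of functionals whose whole orbit lies in the dual
   of the states, hence the largest invariant subset of that dual. *)
Require Import Defs.
From mathcomp Require Import all_boot all_order all_algebra fingroup.
From mathcomp Require Import boolp classical_sets reals convex.

Local Open Scope classical_set_scope.
Local Open Scope ring_scope.

Set Implicit Arguments.
Unset Strict Implicit.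
Unset Printing Implicit Defensive.

Section SystemAction.
Variables (R : realType) (gT : finGroupType) (T : gpt R).
Variable alpha : symmetry_action gT T.

Definition tuple_mulg n (g h : n.-tuple gT) : n.-tuple gT :=
  [tuple (tnth g i * tnth h i)%g | i < n].

Definition tuple_oneg n : n.-tuple gT := [tuple 1%g | i < n].

Lemma system_act1 (s : system T) :
  system_act alpha (tuple_oneg (size s)) = \1%VF.
Proof.
elim: s => [//|w s IH] /=.
have -> : behead_tuple (tuple_oneg (size s).+1) = tuple_oneg (size s).
  by apply: eq_from_tnth => i; rewrite tnth_behead !tnth_mktuple.
by rewrite IH /thead tnth_mktuple wire_act1 tensor_map_id.
Qed.

(** Induction on the wires: the head factor obeys the action law of a single wire, and tensor
    products of maps respect composition. *)
Lemma system_actM (s : system T) (g h : (size s).-tuple gT) :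
  system_act alpha (tuple_mulg g h) =
  (system_act alpha g \o system_act alpha h)%VF.
Proof.
elim: s g h => [|w s IH] g h /=; first by rewrite comp_lfun1l.
have -> : behead_tuple (tuple_mulg g h) =
          tuple_mulg (behead_tuple g) (behead_tuple h).
  by apply: eq_from_tnth => i; rewrite tnth_behead !tnth_mktuple !tnth_behead.
by rewrite IH /thead tnth_mktuple wire_actM tensor_map_comp.
Qed.

(** Lets any vector be put in the form to which [functional_act_pairing] applies, so that the
    inverse in [functional_act] need not be computed. *)
Lemma system_act_surj (s : system T) (g : (size s).-tuple gT)
    (x : system_space s) : exists y, x = system_act alpha g y.
Proof.
exists (system_act alpha (map_tuple (fun a => a^-1%g) g) x).
by have [gV _] := system_actV alpha g; rewrite -comp_lfunE gV lfunE.
Qed.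

Lemma functional_act1 (s : system T) (E : functional (system_space s)) :
  functional_act alpha (tuple_oneg (size s)) E = E.
Proof.
apply/lfunP => x.
have := functional_act_pairing alpha (tuple_oneg (size s)) E x.
by rewrite system_act1 id_lfunE.
Qed.

Lemma functional_actM (s : system T) (g h : (size s).-tuple gT)
    (E : functional (system_space s)) :
  functional_act alpha (tuple_mulg g h) E =
  functional_act alpha g (functional_act alpha h E).
Proof.
apply/lfunP => x.
(* With [x] the image of [z] under [h] and then [g], both sides evaluate to [E z]. *)
have [y ->] := system_act_surj g x; have [z ->] := system_act_surj h y.
by rewrite !functional_act_pairing -comp_lfunE -system_actM
  functional_act_pairing.
Qed.

End SystemAction.

Theorem corollary22 (R : realType) (gT : finGroupType) (T : gpt R)
    (alpha : symmetry_action gT T) :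
  [/\ sectorially_closed alpha (E_max alpha),
      (forall s : system T, E_max alpha s `<=` states_dual s) &
      (forall S : forall s : system T, set (functional (system_space s)),
         sectorially_closed alpha S ->
         (forall s : system T, S s `<=` states_dual s) ->
         forall s : system T, S s `<=` E_max alpha s)].
Proof.
split=> [s g _ [E Emax <-] h|s E Emax|S Sact Ssub s E SE g].
(* Translating by [g] and then [h] is translating by the product of [h] and [g], again a tuple
   covered by [Emax]. *)
- by rewrite -functional_actM; exact: Emax.
- by rewrite -(functional_act1 alpha E); exact: Emax.
(* The whole orbit of [E] stays in [S], hence in the dual. *)
- by apply/Ssub/(Sact s g); exists E.
Qed.
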